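(* Let $N\ge1$ and $n\ge4$, and write $n=2m+4$ if $n$ is even and $n=2m+5$ if $n$ is odd ($m\ge0$ an integer). Consider the $1$-parameter family $\mathcal{X}_t:=\{f_t(\mathbf{x})=0\}$, $t\in\mathbb{C}$, where $$f_0(\mathbf{x}):=\sum_{i=1}^{N-1}x_i^2+x_N^2x_{N+1}+x_{N+1}^{n-1}$$ and either $$f_t(\mathbf{x}):=f_0(\mathbf{x})+t\,(x_N+\mathrm{i}\,t^mx_{N+1})^2+\sum_{k=3}^{2m+2}(-t)^{2m+3-k}x_{N+1}^k\qquad(n\text{ even})$$ or $$f_t(\mathbf{x}):=f_0(\mathbf{x})+t^2(x_N+t^{2m+1}x_{N+1})^2+\sum_{k=3}^{2m+3}(-t^2)^{2m+4-k}x_{N+1}^k\qquad(n\text{ odd}).$$ Then $\mathcal{X}_0$ has an isolated $D_n$ singular point (at the origin) and, for generic $t\in\mathbb{C}$, $\mathcal{X}_t$ admits the unique singular point $\mathbf{0}\in f_t^{-1}(0)$, which is of type $A_{n-1}$.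
   Context: $\mathbf{x}=(x_1,\ldots,x_{N+1})\in\mathbb{C}^{N+1}$ and $\mathrm{i}=\sqrt{-1}$; empty sums are $0$. An isolated hypersurface singularity is of type $A_m$ (resp. $D_m$, $m\ge4$) if it is equivalent, up to a local biholomorphic change of coordinates, to $\sum_{i=1}^Nx_i^2+x_{N+1}^{m+1}=0$ (resp. $\sum_{i=1}^{N-1}x_i^2+x_N^2x_{N+1}+x_{N+1}^{m-1}=0$) at the origin. *)

(* Defs.v *)
From HB Require Import structures.
From mathcomp Require Import all_boot all_order all_algebra.
From mathcomp Require Import all_classical all_reals all_analysis.
From mathcomp Require Import complex.
Set Implicit Arguments.
Unset Strict Implicit.
Unset Printing Implicit Defensive.
Import Order.TTheory GRing.Theory Num.Theory.
Import numFieldNormedType.Exports.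
Local Open Scope classical_set_scope.
Local Open Scope ring_scope.

(* Complex numbers, packed as a numClosedFieldType so that the topology and
   norm that MathComp-Analysis puts on every numFieldType are found on it.
   Differentiability of maps between spaces over [Cplx R] is then complex
   (Fréchet) differentiability. *)
Definition Cplx (R : realType) : numClosedFieldType := (R[i])%type.

Section Singularities.
Variables (R : realType) (N : nat).
Let C := Cplx R.
Implicit Types (f g : 'rV[C]_N.+1 -> C) (p q : 'rV[C]_N.+1).

(* Coordinates are numbered from 1: [coordx x k] is x_k for 1 <= k <= N.+1. *)
Definition coordx (x : 'rV[C]_N.+1) (k : nat) : C := x ord0 (inord k.-1).

Definition singular_point f p :=
  f p = 0 /\ forall j : 'I_N.+1, is_derive p (delta_mx ord0 j) f (0 : C).

Definition isolated_singularity f p :=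
  singular_point f p /\ \forall q \near p, singular_point f q -> q = p.

(* U is meant to be open. *)
Definition holomorphic_on (W : normedModType C) (U : set 'rV[C]_N.+1)
    (h : 'rV[C]_N.+1 -> W) :=
  forall x, U x -> differentiable h x.

(* A biholomorphic map phi : U -> V, with inverse psi, between open
   neighbourhoods of p and q. *)
Definition local_biholomorphism p q (U V : set 'rV[C]_N.+1)
    (phi psi : 'rV[C]_N.+1 -> 'rV[C]_N.+1) :=
  [/\ open U /\ U p, open V /\ V q, phi p = q,
      (forall x, U x -> V (phi x) /\ psi (phi x) = x) /\
      (forall y, V y -> U (psi y) /\ phi (psi y) = y) &
      holomorphic_on U phi /\ holomorphic_on V psi].

(* Equivalence of the hypersurface germs ({f = 0}, p) and ({g = 0}, q): a local
   change of coordinates carries the ideal (g) to the ideal (f), so the two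
   equations correspond up to a nowhere vanishing holomorphic factor. *)
Definition hypersurface_equiv f p g q :=
  exists U V phi psi, local_biholomorphism p q U V phi psi /\
  exists u : 'rV[C]_N.+1 -> C,
    [/\ holomorphic_on U u,
        forall x, U x -> u x != 0 &
        forall x, U x -> f x = u x * g (phi x)].

Definition nfA (m : nat) (x : 'rV[C]_N.+1) : C :=
  \sum_(1 <= i < N.+1) coordx x i ^+ 2 + coordx x N.+1 ^+ m.+1.

Definition nfD (m : nat) (x : 'rV[C]_N.+1) : C :=
  \sum_(1 <= i < N) coordx x i ^+ 2
  + coordx x N ^+ 2 * coordx x N.+1 + coordx x N.+1 ^+ m.-1.

Definition is_type_A (m : nat) f p :=
  isolated_singularity f p /\ hypersurface_equiv f p (nfA m) 0.

(* Only meaningful for 4 <= m (and 1 <= N). *)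
Definition is_type_D (m : nat) f p :=
  isolated_singularity f p /\ hypersurface_equiv f p (nfD m) 0.

(* f_t for n = 2m+4 *)
Definition deformation_even (n m : nat) (t : C) (x : 'rV[C]_N.+1) : C :=
  nfD n x
  + t * (coordx x N + 'i * t ^+ m * coordx x N.+1) ^+ 2
  + \sum_(3 <= k < (2 * m + 2).+1)
      (- t) ^+ (2 * m + 3 - k) * coordx x N.+1 ^+ k.

(* f_t for n = 2m+5 *)
Definition deformation_odd (n m : nat) (t : C) (x : 'rV[C]_N.+1) : C :=
  nfD n x
  + t ^+ 2 * (coordx x N + t ^+ (2 * m + 1) * coordx x N.+1) ^+ 2
  + \sum_(3 <= k < (2 * m + 3).+1)
      (- t ^+ 2) ^+ (2 * m + 4 - k) * coordx x N.+1 ^+ k.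

Definition deformation (n m : nat) : C -> 'rV[C]_N.+1 -> C :=
  if odd n then deformation_odd n m else deformation_even n m.

End Singularities.

(* A property of a complex parameter holds generically when it holds on a
   nonempty Zariski-open subset of the line, i.e. off a finite set. *)
Definition generically (R : realType) (P : Cplx R -> Prop) :=
  exists s : seq (Cplx R), forall t, t \notin s -> P t.

(* Main.v *)
Require Import Defs.
From mathcomp Require Import all_boot all_order all_algebra.
From mathcomp Require Import all_classical all_reals all_analysis.
From mathcomp Require Import ring.
Set Implicit Arguments.
Unset Strict Implicit.
Unset Printing Implicit Defensive.
Import Order.TTheory GRing.Theory Num.Theory numFieldNormedType.Exports.

Local Open Scope classical_set_scope.
Local Open Scope ring_scope.

(** Write y = x_N and z = x_{N+1}. Both families have the form
<<
  f = sum_{i<N} x_i^2 + (z + tau) y^2 + 2 c y z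
        + sum_{2 <= k < n} (-tau)^(n-1-k) z^k,     c^2 = - (-tau)^(n-2),
>>
    with tau = t, c = i t^(m+1) for n even and tau = t^2, c = t^(2m+3) for n
    odd ([deformation_completed]). The last sum is z^2 times the quotient of
    z^(n-2) - (-tau)^(n-2) by z + tau, so completing the square in y makes
    everything collapse ([complete_square]):
<<
  (z + tau) (f - sum_{i<N} x_i^2) = ((z + tau) y + c z)^2 + z^n.
>>
    Singular points. The partial derivatives kill x_i for i < N and the form
    (z + tau) y + c z, which is half of df/dy. With f = 0 the identity then gives
    z^n = 0, hence z = 0 and tau y = 0. If tau = 0 then c = 0 and df/dz = y^2 at
    such a point. So the origin is the only singular point for every value of the
    parameter, t = 0 included ([singular_completed_family]), and in particular it
    is isolated. At t = 0 the equation is the D_n normal form itself.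

    Type A. If t is not 0 then tau is not 0, and z + tau is a unit near the
    origin with a holomorphic square root s ([local_square_root]). By the identity,
<<
  x |-> (s(z + tau) x_1, ..., s(z + tau) x_{N-1}, (z + tau) y + c z, z)
>>
    carries (z + tau) f to the A_{n-1} normal form. This map is affine on each
    slice of constant z, so its inverse is explicit and no inverse function
    theorem is involved ([completed_family_equiv_A]). *)

(** * A holomorphic square root *)

(** With b a root of a, let s w be the root of w that is nearest to b. Then
    |s w + b| >= |b|, and (s w - b) (s w + b) = w - a keeps s w within |b| / 2
    of b on the disc. Hence |s w + s w'| > |b| for w and w' in the disc, and the
    difference quotient of s is exactly 1 / (s w + s w'). *)
Lemma local_square_root (K : numClosedFieldType) (a : K) : a != 0 ->
  exists s : K -> K, forall w, `|w - a| < `|a| / 2 ->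
    [/\ s w ^+ 2 = w, s w != 0 & differentiable s w].
Proof.
move=> a0; pose b := sqrtC a.
have b2 : b ^+ 2 = a by exact: sqrtCK.
have b0 : 0 < `|b| by rewrite normr_gt0 -sqrf_eq0 b2.
have na : `|a| = `|b| ^+ 2 by rewrite -b2 normrX.
pose s w := if `|sqrtC w - b| <= `|sqrtC w + b| then sqrtC w else - sqrtC w.
have s2 w : s w ^+ 2 = w by rewrite /s; case: ifP => _; rewrite ?sqrrN sqrtCK.
have sle w : `|s w - b| <= `|s w + b|.
  rewrite /s.
  have [//|] := real_leP (normr_real (sqrtC w - b)) (normr_real (sqrtC w + b)).
  by move=> /ltW; rewrite -opprD normrN -[in X in _ <= X]normrN opprD opprK.
have sge w : `|b| <= `|s w + b|.
  rewrite -(ler_pMn2r (ltn0Sn 1)) -normrMn.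
  have -> : b *+ 2 = (s w + b) - (s w - b) by ring.
  by rewrite (le_trans (ler_normB _ _))// mulr2n lerD2l.
have sclose w : `|w - a| < `|a| / 2 -> `|s w - b| < `|b| / 2.
  move=> wa; rewrite -(ltr_pM2r b0) (@le_lt_trans _ _ `|w - a|)//.
    by rewrite -[in leRHS](s2 w) -b2 subr_sqr normrM ler_wpM2l.
  by rewrite mulrAC -expr2 -na.
have sadd w w' : `|w - a| < `|a| / 2 -> `|w' - a| < `|a| / 2 ->
    `|b| < `|s w' + s w|.
  move=> /sclose wa /sclose w'a.
  have h : `|b| *+ 2 <= `|s w' + s w| + (`|s w' - b| + `|s w - b|).
    rewrite -normrMn.
    have -> : b *+ 2 = (s w' + s w) - ((s w' - b) + (s w - b)) by ring.
    by rewrite (le_trans (ler_normB _ _))// lerD2l ler_normD.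
  have h' : `|s w' - b| + `|s w - b| < `|b| by rewrite [ltRHS]splitr ltrD.
  by rewrite -(ltrD2r `|b|) -mulr2n (le_lt_trans h)// ltrD2l.
exists s => w wa; split => //.
  apply/eqP => s0; have := sadd _ _ wa wa.
  by rewrite s0 addr0 normr0 => /(lt_trans b0); rewrite ltxx.
have nw : \forall h \near (0 : K), `|(h + w) - a| < `|a| / 2.
  apply/nbhs_norm0P; exists (`|a| / 2 - `|w - a|).
    by rewrite /= subr_gt0.
  move=> h /=; rewrite ltrBrDr -addrA; apply: le_lt_trans.
  exact: ler_normD.
(* Continuity: |s (h + w) - s w| = |h| / |s (h + w) + s w| <= |h| / |b|. *)
have cs : s (h + w) @[h --> (0 : K)] --> s w.
  have FK : Filter (nbhs (0 : K)) by exact: nbhs_filter.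
  apply/(cvgrPdist_lt (FF := FK)) => e e0.
  have : \forall h \near (0 : K), `|h| < e * `|b|.
    by apply/nbhs_norm0P; exists (e * `|b|) => //=; rewrite mulr_gt0.
  move=> he; near=> h.
  have hh : `|h| < e * `|b| by near: h.
  have /sadd - /(_ _ wa) hs : `|(h + w) - a| < `|a| / 2 by near: h.
  rewrite -(ltr_pM2r b0); apply: le_lt_trans hh.
  have eh : h = (s (h + w) - s w) * (s (h + w) + s w).
    by rewrite -subr_sqr !s2 addrK.
  by rewrite distrC [leRHS](congr1 Num.norm eh) normrM ler_wpM2l// addrC ltW.
apply/derivable1_diffP; apply/cvg_ex; exists ((s w + s w)^-1).
have ss0 : s w + s w != 0 by rewrite -normr_gt0 (lt_trans b0)// sadd.
have : (s (h + w) + s w)^-1 @[h --> 0^'] --> (s w + s w)^-1.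
  apply: cvgV => //; apply: cvgD; last exact: cvg_cst.
  by apply: cvg_trans cs; apply: cvg_app; exact: nbhs_dnbhs.
apply: cvg_trans; apply: near_eq_cvg; near=> h.
have h0 : h != 0 by near: h; exact: nbhs_dnbhs_neq.
have /sadd - /(_ _ wa) hs : `|(h + w) - a| < `|a| / 2 by near: h; apply: nbhs_dnbhs.
have sn : s (h + w) + s w != 0 by rewrite -normr_gt0 addrC (lt_trans b0)// addrC.
rewrite /= [h%:A]mulr1 -[_ *: _]/(_ * _).
have -> : s (h + w) - s w = h / (s (h + w) + s w).
  by apply: (mulIf sn); rewrite -subr_sqr !s2 addrK divfK.
by rewrite mulKf.
Unshelve. all: by end_near.
Qed.

(** * The completed family and its partial derivatives *)

Lemma is_derive_bigsum (K : numFieldType) (V W : normedModType K) (I : Type)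
    (r : seq I) (f : I -> V -> W) (df : I -> W) (p v : V) :
  (forall i, is_derive p v (f i) (df i)) ->
  is_derive p v (fun x => \sum_(i <- r) f i x) (\sum_(i <- r) df i).
Proof.
move=> fdf; rewrite -fct_sumE.
by elim/big_ind2 : _ => // [|*]; [exact: is_derive_cst|exact: is_deriveD].
Qed.

Lemma is_derive_coordx (R : realType) (N k : nat) (p v : 'rV[Cplx R]_N.+1) :
  is_derive p v (fun x => coordx x k) (coordx v k).
Proof.
have qv : (fun h : Cplx R => h^-1 *: (coordx (h *: v + p) k - coordx p k))
    @ 0^' --> coordx v k.
  apply: cvg_trans (@cvg_cst _ (coordx v k) _ 0^' _).
  apply: near_eq_cvg; near=> h.
  have h0 : h != 0 by near: h; exact: nbhs_dnbhs_neq.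
  by rewrite /coordx !mxE addrK; rewrite -[_ *: _]/(_ * _) mulKf.
apply: DeriveDef; first by apply/cvg_ex; exists (coordx v k).
exact: cvg_lim qv.
Unshelve. all: by end_near.
Qed.

Lemma differentiable_coordx (R : realType) (N k : nat) (p : 'rV[Cplx R]_N.+1) :
  differentiable (fun x => coordx x k) p.
Proof. exact: differentiable_coord. Qed.

(** The quotient of a^r - z^r by a - z, written as a sum so that it makes sense
    at z = a. *)
Definition geometric_quotient (K : comNzRingType) (a : K) (r : nat) (z : K) : K :=
  \sum_(0 <= i < r) a ^+ (r.-1 - i) * z ^+ i.

(** The common form of both deformations, arranged as a quadratic polynomial in
    x_N with coefficients in x_{N+1}; here r stands for n - 2. *)
Definition completed_family (R : realType) (N r : nat) (tau c : Cplx R)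
    (x : 'rV[Cplx R]_N.+1) : Cplx R :=
  \sum_(1 <= i < N) coordx x i ^+ 2
  + ((coordx x N.+1 + tau) * coordx x N ^+ 2
     + 2 * c * coordx x N * coordx x N.+1)
  + coordx x N.+1 ^+ 2 * geometric_quotient (- tau) r (coordx x N.+1).

(** The factor d comes from differentiating the geometric sum. It is left
    implicit because it is multiplied by x_{N+1}, which vanishes wherever the
    derivative along x_{N+1} is used. *)
Lemma derive_completed_family (R : realType) (N r : nat) (tau c : Cplx R)
    (p v : 'rV[Cplx R]_N.+1) :
  exists d : Cplx R, is_derive p v (completed_family (N:=N) r tau c)
    (\sum_(1 <= i < N) 2 * coordx p i * coordx v i
     + (2 * ((coordx p N.+1 + tau) * coordx p N + c * coordx p N.+1)
          * coordx v N
        + (coordx p N ^+ 2 + 2 * c * coordx p N + coordx p N.+1 * d)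
          * coordx v N.+1)).
Proof.
pose D k := @is_derive_coordx R N k p v.
have DX j k : is_derive p v (fun x => coordx x j ^+ k)
    (k%:R * coordx p j ^+ k.-1 * coordx v j).
  have := is_deriveX k (D j).
  by congr is_derive; apply/funext => x; rewrite exprfctE.
have De := is_derive_bigsum (index_iota 0 r)
  (fun i => is_deriveM (is_derive_cst ((- tau) ^+ (r.-1 - i)) p v) (DX N.+1 i)).
set e := (X in is_derive _ _ _ X) in De.
pose e' := \sum_(0 <= i < r)
  (- tau) ^+ (r.-1 - i) * (i%:R * coordx p N.+1 ^+ i.-1).
have eE : e = e' * coordx v N.+1.
  rewrite mulr_suml; apply: eq_bigr => i _.
  by rewrite scaler0 addr0 -[LHS]/(_ * (_ * _ * _)) !mulrA.
exists (2 * geometric_quotient (- tau) r (coordx p N.+1)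
  + coordx p N.+1 * e').
have DS := is_derive_bigsum (index_iota 1 N) (DX ^~ 2%N).
have DF := is_deriveD (is_deriveD DS (is_deriveD
  (is_deriveM (is_deriveD (D N.+1) (is_derive_cst tau p v)) (DX N 2%N))
  (is_deriveM (is_deriveM (is_derive_cst (2 * c) p v) (D N)) (D N.+1))))
  (is_deriveM (DX N.+1 2%N) De).
apply: (is_derive_eq DF); rewrite eE.
rewrite -[LHS]/(\sum_(1 <= i < N) 2 * coordx p i * coordx v i
  + ((coordx p N.+1 + tau) * (2 * coordx p N * coordx v N)
     + coordx p N ^+ 2 * (coordx v N.+1 + 0)
     + (2 * c * coordx p N * coordx v N.+1
        + coordx p N.+1 * (2 * c * coordx v N + coordx p N * 0)))
  + (coordx p N.+1 ^+ 2 * (e' * coordx v N.+1)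
     + geometric_quotient (- tau) r (coordx p N.+1)
       * (2 * coordx p N.+1 * coordx v N.+1))).
ring.
Qed.

(** Multiplying by z + tau turns the geometric quotient into
    z^r - (-tau)^r = z^r + c^2, and the c^2 z^2 so produced is what completes
    the square of (z + tau) y + c z. *)
Lemma complete_square (K : comNzRingType) (r : nat) (tau c y z : K) :
  c ^+ 2 = - (- tau) ^+ r ->
  (z + tau) * ((z + tau) * y ^+ 2 + 2 * c * y * z
               + z ^+ 2 * geometric_quotient (- tau) r z)
  = ((z + tau) * y + c * z) ^+ 2 + z ^+ r.+2.
Proof.
move=> cE.
have geo : (z + tau) * geometric_quotient (- tau) r z = z ^+ r + c ^+ 2.
  rewrite cE /geometric_quotient big_mkord -[LHS]opprK -mulNr opprD addrC.
  by rewrite -subrXX opprB.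
have -> : z ^+ r.+2 = z ^+ 2 * z ^+ r by rewrite -exprD.
have -> : z ^+ r = (z + tau) * geometric_quotient (- tau) r z - c ^+ 2.
  by rewrite geo addrK.
ring.
Qed.

(** * Singular points *)

Lemma eq_coordx (R : realType) (N : nat) (x y : 'rV[Cplx R]_N.+1) :
  (forall k, (0 < k <= N.+1)%N -> coordx x k = coordx y k) -> x = y.
Proof.
move=> xy; apply/rowP => j; have := xy j.+1.
by rewrite ltn_ord /coordx /= inord_val => ->.
Qed.

Lemma coordx_delta (R : realType) (N k l : nat) :
  (0 < k <= N.+1)%N -> (0 < l <= N.+1)%N ->
  coordx (delta_mx ord0 (inord l.-1) : 'rV[Cplx R]_N.+1) k = if k == l then 1 else 0.
Proof.
case: k l => [|k] [|l] // kN lN; rewrite /coordx mxE eqxx /= -val_eqE /=.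
by rewrite !inordK // eqSS; case: eqP.
Qed.

Lemma coordx0 (R : realType) (N k : nat) : coordx (0 : 'rV[Cplx R]_N.+1) k = 0.
Proof. by rewrite /coordx mxE. Qed.

Lemma sum_nat_indicator (K : pzRingType) (m n k : nat) (a : nat -> K) :
  \sum_(m <= i < n) a i * (if i == k then 1 else 0)
  = if (m <= k < n)%N then a k else 0.
Proof.
rewrite -mem_index_iota (eq_bigr (fun i => if i == k then a k else 0)); last first.
  by move=> i _; case: eqP => [->|_]; rewrite ?mulr1 ?mulr0.
rewrite -big_mkcond /=; case: ifP => kI.
  by rewrite -big_filter filter_pred1_uniq ?iota_uniq // big_seq1.
by rewrite big1_seq // => i /andP[/eqP-> ]; rewrite kI.
Qed.

(** The derivative along x_N together with the vanishing of the function forces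
    z = 0 through [complete_square]. The derivative along x_{N+1} is needed only
    when tau = 0: then c = 0, and it reduces to y^2. *)
Lemma singular_completed_family (R : realType) (N r : nat) (tau c : Cplx R)
    (p : 'rV[Cplx R]_N.+1) :
  (1 <= N)%N -> (1 <= r)%N -> c ^+ 2 = - (- tau) ^+ r ->
  singular_point (completed_family (N:=N) r tau c) p <-> p = 0.
Proof.
move=> N1 r1 cE; split; last first.
  move=> ->; split.
    rewrite /completed_family !coordx0 big1 => [|i _]; rewrite ?coordx0 ?expr0n//.
    by rewrite /= !(mulr0, mul0r, addr0).
  move=> j.
  have [d /is_derive_eq] :=
    derive_completed_family r tau c 0 (delta_mx ord0 j).
  apply; rewrite !coordx0 big1 => [|i _]; rewrite ?coordx0 ?mulr0 ?mul0r//.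
  by rewrite !(mulr0, mul0r, addr0, expr0n).
move=> [p0 dp].
have grad k : (0 < k <= N.+1)%N -> exists d,
    \sum_(1 <= i < N) 2 * coordx p i * (if i == k then 1 else 0)
     + (2 * ((coordx p N.+1 + tau) * coordx p N + c * coordx p N.+1)
          * (if N == k then 1 else 0)
        + (coordx p N ^+ 2 + 2 * c * coordx p N + coordx p N.+1 * d)
          * (if N.+1 == k then 1 else 0)) = 0.
  move=> kN; have := dp (inord k.-1) => dk.
  have [d dF] := derive_completed_family r tau c p (delta_mx ord0 (inord k.-1)).
  exists d; have := derive_val (is_derive := dk).
  rewrite (derive_val (is_derive := dF)).
  rewrite !coordx_delta ?N1 ?leqnn ?leqnSn // => dF0; rewrite -[RHS]dF0.
  congr (_ + _); apply: eq_big_nat => i /andP[i1 iN].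
  by rewrite coordx_delta // i1 ltnW // ltnS ltnW.
have two0 (a : Cplx R) : 2 * a = 0 -> a = 0.
  by move/eqP; rewrite mulf_eq0 pnatr_eq0 => /eqP.
have xi0 i : (0 < i < N)%N -> coordx p i = 0.
  move=> /andP[i1 iN]; have [|d] := grad i; first by rewrite i1 ltnW // ltnS ltnW.
  rewrite (gtn_eqF iN) (gtn_eqF (ltnW iN : (i < N.+1)%N)) => di.
  apply: two0; rewrite -[RHS]di.
  by rewrite sum_nat_indicator i1 iN; cbv iota beta delta [andb]; ring.
have Fy : (coordx p N.+1 + tau) * coordx p N + c * coordx p N.+1 = 0.
  have [|d] := grad N; first by rewrite N1 leqnSn.
  rewrite sum_nat_indicator ltnn andbF eqxx (gtn_eqF (ltnSn N)) => dN.
  by apply: two0; rewrite -[RHS]dN; cbv iota; ring.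
have z0 : coordx p N.+1 = 0.
  have := complete_square (coordx p N) (coordx p N.+1) cE.
  rewrite Fy expr0n add0r; move: p0; rewrite /completed_family big_nat big1 ?add0r.
    by move=> ->; rewrite mulr0 => /esym/eqP; rewrite expf_eq0 => /eqP.
  by move=> i iN; rewrite xi0 // expr0n.
have y0 : coordx p N = 0.
  move: Fy; rewrite z0 add0r mulr0 addr0 => /eqP.
  rewrite mulf_eq0 => /orP[/eqP t0|/eqP//].
  have c0 : c = 0.
    by apply/eqP; rewrite -sqrf_eq0 cE t0 oppr0 expr0n gtn_eqF // oppr0.
  have [|d] := grad N.+1; first by rewrite leqnn.
  rewrite sum_nat_indicator [X in _ && X]ltnNge leqnSn andbF eqxx.
  rewrite (ltn_eqF (ltnSn N)) z0 c0 => dz.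
  by apply/eqP; rewrite -sqrf_eq0 -[X in _ == X]dz; apply/eqP; cbv iota; ring.
apply: eq_coordx => k /andP[k1]; rewrite coordx0 leq_eqVlt => /predU1P[->//|].
by rewrite ltnS leq_eqVlt => /predU1P[->//|kN]; rewrite xi0 ?k1.
Qed.

(** * Both deformations are completed families *)

(** The extreme terms of the geometric sum are not part of the sum over
    3 <= k in the deformation: the lowest is the z^2 term of the expanded square
    and the highest is the z^(n-1) of the D_n normal form. *)
Lemma geometric_quotient_split (K : comNzRingType) (a z : K) (l : nat) :
  z ^+ 2 * geometric_quotient a l.+2 z
  = a ^+ l.+1 * z ^+ 2 + \sum_(3 <= k < l.+3) a ^+ (l.+3 - k) * z ^+ k
    + z ^+ l.+3.
Proof.
rewrite /geometric_quotient big_nat_recr //= big_nat_recl //= subn0 subnn.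
rewrite (big_addn 0 l.+3 3) subSS subSS subSS subn0 !expr0 mulr1 mul1r.
rewrite !mulrDr mulr_sumr (exprD z 2 l.+1) [z ^+ 2 * _]mulrC; congr (_ + _ + _).
  apply: eq_big_nat => i /andP[_ il].
  by rewrite addn3 !subSS mulrCA -exprD.
Qed.

Lemma deformation_evenE (R : realType) (N m : nat) (t : Cplx R) :
  @deformation_even R N (2 * m + 4) m t
  = completed_family (2 * m + 2) t ('i * t ^+ m.+1).
Proof.
apply/funext => x; rewrite /completed_family /deformation_even /nfD.
(* Exponents are put in successor form, in terms of 2m. *)
have -> : (2 * m + 2 = (2 * m).+2)%N by rewrite addn2.
have -> : (2 * m + 4 = (2 * m).+4)%N by rewrite addn4.
have -> : (2 * m + 3 = (2 * m).+3)%N by rewrite addn3.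
rewrite geometric_quotient_split.
have -> : (- t) ^+ (2 * m).+1 = - (t * (t ^+ m) ^+ 2).
  by rewrite exprNn -signr_odd /= oddM /= expr1 mulN1r exprS mulnC exprM.
have i2 : 'i ^+ 2 = -1 :> Cplx R by exact: sqrCi.
rewrite [t ^+ m.+1]exprS.
by rewrite succnK; ring: i2.
Qed.

Lemma deformation_oddE (R : realType) (N m : nat) (t : Cplx R) :
  @deformation_odd R N (2 * m + 5) m t
  = completed_family (2 * m + 3) (t ^+ 2) (t ^+ (2 * m + 3)).
Proof.
apply/funext => x; rewrite /completed_family /deformation_odd /nfD.
have -> : (2 * m + 1 = (2 * m).+1)%N by rewrite addn1.
have -> : (2 * m + 3 = (2 * m).+3)%N by rewrite addn3.
have -> : (2 * m + 4 = (2 * m).+4)%N by rewrite addn4.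
have -> : (2 * m + 5 = (2 * m).+1.+4)%N by rewrite !addnS addn0.
rewrite geometric_quotient_split.
have -> : (- t ^+ 2) ^+ (2 * m).+2 = (t * t ^+ (2 * m).+1) ^+ 2.
  rewrite exprNn -signr_odd /= negbK oddM /= expr0 mul1r -exprM -exprS.
  by rewrite -exprM mulnC.
have -> : t ^+ (2 * m).+3 = t ^+ 2 * t ^+ (2 * m).+1 by rewrite -exprD.
by rewrite succnK; ring.
Qed.

Lemma deformation_completed (R : realType) (N n m : nat) (t : Cplx R) :
  n = (if odd n then 2 * m + 5 else 2 * m + 4)%N ->
  exists tau c : Cplx R,
    [/\ @deformation R N n m t = completed_family n.-2 tau c,
        c ^+ 2 = - (- tau) ^+ n.-2 & tau = 0 -> t = 0].
Proof.
rewrite /deformation; case: (odd n) => ->; last first.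
  exists t, ('i * t ^+ m.+1); rewrite deformation_evenE; split => //.
    by rewrite !addnS addn0.
  rewrite !addnS addn0 /= exprNn -signr_odd oddS oddS oddM expr0 mul1r exprMn.
  by rewrite sqrCi mulN1r -exprM mulnC mulnS.
exists (t ^+ 2), (t ^+ (2 * m + 3)); rewrite deformation_oddE; split.
- by rewrite !addnS addn0.
- rewrite !addnS addn0 /= exprNn -signr_odd oddS oddS oddS oddM expr1 mulN1r opprK.
  by rewrite -!exprM mulnC.
- by move=> /eqP; rewrite sqrf_eq0 => /eqP.
Qed.

(** Every coefficient (-t)^j or (-t^2)^j in the sum has j > 0. *)
Lemma deformation0 (R : realType) (N n m : nat) :
  @deformation R N n m 0 = nfD n.
Proof.
have sum0 (a z : Cplx R) M L : (M <= L)%N -> a = 0 ->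
    \sum_(3 <= k < M) a ^+ (L - k) * z ^+ k = 0.
  move=> ML ->; rewrite big_nat big1 // => k /andP[_ kM].
  by rewrite expr0n subn_eq0 leqNgt (leq_trans kM ML) mul0r.
apply/funext => x; rewrite /deformation; case: (odd n).
  rewrite /deformation_odd sum0.
  - by rewrite expr0n mul0r !addr0.
  - by rewrite !addnS.
  - by rewrite expr0n oppr0.
rewrite /deformation_even sum0.
- by rewrite mul0r !addr0.
- by rewrite !addnS.
- by rewrite oppr0.
Qed.

(** * Changes of coordinates that are affine on each slice x_{N+1} = z *)

(** Coordinates are numbered from 1, as for [coordx]. *)
Definition row_of_coordinates (R : realType) (N : nat) (g : nat -> Cplx R) :
  'rV[Cplx R]_N.+1 := \row_j g j.+1.

Lemma coordx_row (R : realType) (N k : nat) (g : nat -> Cplx R) :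
  (0 < k <= N.+1)%N -> coordx (row_of_coordinates N g) k = g k.
Proof. by case: k => [|k] // kN; rewrite /coordx mxE /= inordK. Qed.

Lemma differentiable_row (R : realType) (N : nat)
    (g : 'rV[Cplx R]_N.+1 -> nat -> Cplx R) (x : 'rV[Cplx R]_N.+1) :
  (forall k, differentiable (g ^~ k) x) ->
  differentiable (fun y => row_of_coordinates N (g y)) x.
Proof.
move=> dg.
have -> : (fun y => row_of_coordinates N (g y))
    = \sum_(j < N.+1) (fun y => g y j.+1 *: delta_mx ord0 j : 'rV[Cplx R]_N.+1).
  apply/funext => y; rewrite fct_sumE [LHS]row_sum_delta.
  by apply: eq_bigr => j _; rewrite mxE.
by apply: differentiable_sum => j; exact: differentiableZl.
Qed.

(** On each slice where x_{N+1} = z this scales x_1, ..., x_{N-1} by al z and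
    sends x_N to be z * x_N + ga z * z. The chart to the A normal form and its
    inverse are both of this shape. *)
Definition fiberwise_affine (R : realType) (N : nat)
    (al be ga : Cplx R -> Cplx R) (x : 'rV[Cplx R]_N.+1) : 'rV[Cplx R]_N.+1 :=
  row_of_coordinates N (fun k =>
    if k == N.+1 then coordx x N.+1
    else if k == N
      then be (coordx x N.+1) * coordx x N + ga (coordx x N.+1) * coordx x N.+1
    else al (coordx x N.+1) * coordx x k).

Lemma fiberwise_affine_last (R : realType) (N : nat)
    (al be ga : Cplx R -> Cplx R) (x : 'rV[Cplx R]_N.+1) :
  coordx (fiberwise_affine al be ga x) N.+1 = coordx x N.+1.
Proof. by rewrite coordx_row ?eqxx ?leqnn. Qed.

Lemma fiberwise_affine_penultimate (R : realType) (N : nat)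
    (al be ga : Cplx R -> Cplx R) (x : 'rV[Cplx R]_N.+1) : (1 <= N)%N ->
  coordx (fiberwise_affine al be ga x) N
  = be (coordx x N.+1) * coordx x N + ga (coordx x N.+1) * coordx x N.+1.
Proof.
by move=> N1; rewrite coordx_row ?N1 ?leqnSn // eqxx (ltn_eqF (ltnSn N)).
Qed.

Lemma fiberwise_affine_other (R : realType) (N k : nat)
    (al be ga : Cplx R -> Cplx R) (x : 'rV[Cplx R]_N.+1) : (1 <= k < N)%N ->
  coordx (fiberwise_affine al be ga x) k = al (coordx x N.+1) * coordx x k.
Proof.
move=> /andP[k1 kN]; rewrite coordx_row; last by rewrite k1 leqW // ltnW.
by rewrite (ltn_eqF kN) (ltn_eqF (ltnW kN : (k < N.+1)%N)).
Qed.

Lemma fiberwise_affineK (R : realType) (N : nat)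
    (al be ga al' be' ga' : Cplx R -> Cplx R) (x : 'rV[Cplx R]_N.+1) :
  (1 <= N)%N ->
  let z := coordx x N.+1 in
  al' z * al z = 1 -> be' z * be z = 1 -> be' z * ga z + ga' z = 0 ->
  fiberwise_affine al' be' ga' (fiberwise_affine al be ga x) = x.
Proof.
move=> N1 z alK beK gaK; apply: eq_coordx => k /andP[k1].
rewrite leq_eqVlt => /predU1P[->|]; first by rewrite !fiberwise_affine_last.
rewrite ltnS leq_eqVlt => /predU1P[->|kN].
  rewrite !fiberwise_affine_penultimate // fiberwise_affine_last -/z.
  by rewrite mulrDr !mulrA -addrA -mulrDl beK gaK mul1r mul0r addr0.
have kI : (1 <= k < N)%N by rewrite k1.
rewrite !(fiberwise_affine_other _ _ _ _ kI) fiberwise_affine_last -/z.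
by rewrite mulrA alK mul1r.
Qed.

Lemma fiberwise_affine0 (R : realType) (N : nat)
    (al be ga : Cplx R -> Cplx R) :
  fiberwise_affine al be ga (0 : 'rV[Cplx R]_N.+1) = 0.
Proof.
apply/rowP => j; rewrite !mxE !coordx0 !mulr0.
by case: eqP => // _; case: eqP => // _; rewrite addr0.
Qed.

Lemma differentiable_fiberwise_affine (R : realType) (N : nat)
    (al be ga : Cplx R -> Cplx R) (x : 'rV[Cplx R]_N.+1) :
  differentiable al (coordx x N.+1) -> differentiable be (coordx x N.+1) ->
  differentiable ga (coordx x N.+1) ->
  differentiable (fiberwise_affine (N:=N) al be ga) x.
Proof.
move=> dal dbe dga; apply: differentiable_row => k.
have dx j := differentiable_coordx j x.
have dcomp (h : Cplx R -> Cplx R) : differentiable h (coordx x N.+1) ->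
    differentiable (fun y : 'rV[Cplx R]_N.+1 => h (coordx y N.+1)) x.
  exact: differentiable_comp (dx N.+1).
case: eqP => _; first exact: dx.
case: eqP => _; last exact: differentiableM (dcomp _ dal) (dx k).
exact: differentiableD (differentiableM (dcomp _ dbe) (dx N))
  (differentiableM (dcomp _ dga) (dx N.+1)).
Qed.

(** * The A singularity *)

(** On the region |x_{N+1}| < |tau| / 2 the function w = x_{N+1} + tau has no
    zero and has a holomorphic square root s. The chart multiplies x_i by s for
    i < N, so that w x_i^2 becomes a square, and takes w x_N + c x_{N+1} as new
    x_N. The remaining factor 1 / w is the unit. The region depends on x_{N+1}
    alone, which the chart fixes, so it serves as source and as target. *)
Lemma completed_family_equiv_A (R : realType) (N r : nat) (tau c : Cplx R) :
  (1 <= N)%N -> tau != 0 -> c ^+ 2 = - (- tau) ^+ r ->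
  hypersurface_equiv (completed_family (N:=N) r tau c) 0 (nfA r.+1) 0.
Proof.
move=> N1 tau0 cE; have [s sP] := local_square_root tau0.
pose U := [set x : 'rV[Cplx R]_N.+1 |
  ball (0 : Cplx R) (`|tau| / 2) (coordx x N.+1)].
pose phi := fiberwise_affine (N:=N) (fun z => s (z + tau))
  (fun z => z + tau) (fun=> c).
pose psi := fiberwise_affine (N:=N) (fun z => (s (z + tau))^-1)
  (fun z => (z + tau)^-1) (fun z => - ((z + tau)^-1 * c)).
have rootU x : U x -> [/\ s (coordx x N.+1 + tau) ^+ 2 = coordx x N.+1 + tau,
    s (coordx x N.+1 + tau) != 0 & differentiable s (coordx x N.+1 + tau)].
  by rewrite /U /= -ball_normE /= sub0r normrN => xU; apply: sP; rewrite addrK.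
have unitU x : U x -> coordx x N.+1 + tau != 0.
  by move=> /rootU[sE s0 _]; rewrite -sE sqrf_eq0.
have U0 : U 0.
  by rewrite /U /= coordx0; apply: ballxx; rewrite divr_gt0 // normr_gt0.
have oU : open U.
  apply: (@open_comp _ _ (fun x : 'rV[Cplx R]_N.+1 => coordx x N.+1)).
    by move=> x _; exact/differentiable_continuous/differentiable_coordx.
  exact: ball_open.
have dw x : differentiable (fun z : Cplx R => z + tau) x.
  exact: differentiableD (@differentiable_cst _ _ _ tau x).
have ds x : U x -> differentiable (fun z => s (z + tau)) (coordx x N.+1).
  by move=> /rootU[_ _ ds]; exact: differentiable_comp (dw _) ds.
exists U, U, phi, psi; split.
  split => //; first exact: fiberwise_affine0.
    split => x xU; (split; first by rewrite /U /= fiberwise_affine_last).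
      apply: fiberwise_affineK => //.
      - by rewrite mulVf //; have [] := rootU _ xU.
      - by rewrite mulVf // unitU.
      - by rewrite subrr.
    apply: fiberwise_affineK => //.
    - by rewrite mulfV //; have [] := rootU _ xU.
    - by rewrite mulfV // unitU.
    - by rewrite mulrN mulrA mulfV ?unitU // mul1r addNr.
  split => x xU; apply: differentiable_fiberwise_affine.
  - exact: ds.
  - exact: dw.
  - exact: differentiable_cst.
  - by apply: differentiableV; [exact: ds|have [] := rootU _ xU].
  - by apply: differentiableV; [exact: dw|exact: unitU].
  - apply: differentiableN; apply: differentiableM; last exact: differentiable_cst.
    by apply: differentiableV; [exact: dw|exact: unitU].
exists (fun x => (coordx x N.+1 + tau)^-1); split.
- move=> x xU; apply: differentiableV; last exact: unitU.
  exact: differentiable_comp (differentiable_coordx N.+1 x) (dw _).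
- by move=> x xU; rewrite invr_eq0 unitU.
(* The factorisation is checked after multiplying by w. *)
move=> x xU; have w0 := unitU _ xU; apply: (mulfI w0).
rewrite mulVKf // /completed_family /nfA -addrA mulrDr complete_square //.
have -> : \sum_(1 <= k < N.+1) coordx (phi x) k ^+ 2
    = (coordx x N.+1 + tau) * \sum_(1 <= k < N) coordx x k ^+ 2
      + ((coordx x N.+1 + tau) * coordx x N + c * coordx x N.+1) ^+ 2.
  rewrite big_nat_recr //; congr (_ + _).
    rewrite mulr_sumr; apply: eq_big_nat => k kN.
    rewrite (fiberwise_affine_other _ _ _ _ kN) exprMn.
    by have [->] := rootU _ xU.
  by rewrite fiberwise_affine_penultimate.
by rewrite fiberwise_affine_last addrA.
Qed.

Lemma hypersurface_equiv_refl (R : realType) (N : nat)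
    (f : 'rV[Cplx R]_N.+1 -> Cplx R) (p : 'rV[Cplx R]_N.+1) :
  hypersurface_equiv f p f p.
Proof.
exists setT, setT, id, id; split.
  split; [by split; [exact: openT|]..|by []|by split|].
  by split => x _; exact: (@ex_diff _ _ _ _ _ _ _ (is_diff_id x)).
exists (fun=> 1); split => x _; [exact: differentiable_cst|exact: oner_neq0|].
by rewrite mul1r.
Qed.

(** * The theorem *)

(** Generic means that t is not 0. *)
Theorem mainTheorem6 (R : realType) (N n m : nat)
    (hN : (1 <= N)%N) (hn : (4 <= n)%N)
    (hnm : n = (if odd n then 2 * m + 5 else 2 * m + 4)%N) :
  is_type_D n (@deformation R N n m 0) 0 /\
  generically (fun t : Cplx R =>
    (forall p : 'rV[Cplx R]_N.+1,
       singular_point (@deformation R N n m t) p <-> p = 0) /\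
    is_type_A n.-1 (@deformation R N n m t) 0).
Proof.
have sing t (p : 'rV[Cplx R]_N.+1) :
    singular_point (@deformation R N n m t) p <-> p = 0.
  have [tau [c [-> cE _]]] := deformation_completed N t hnm.
  by apply: singular_completed_family => //; case: (n) hn => [|[|[]]].
have isol t : isolated_singularity (@deformation R N n m t) 0.
  split; first exact/sing.
  by apply: (@filterE _ (nbhs _) (nbhs_filter _)) => q /sing.
split; first by split; [exact: isol|rewrite deformation0; exact: hypersurface_equiv_refl].
exists [:: 0] => t; rewrite inE => t0; split; first exact: sing.
split; first exact: isol.
have [tau [c [-> cE tau0]]] := deformation_completed N t hnm.
have -> : n.-1 = n.-2.+1 by case: (n) hn => [|[|[]]].
apply: completed_family_equiv_A => //.
by apply: contra_neq t0 => /tau0.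
Qed.
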